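(* Let $\lambda,\mu,\rho,\omega>0$, $\delta\ge 0$, and set $C_p=\sqrt{(\lambda+2\mu)/\rho}$, $C_s=\sqrt{\mu/\rho}$. For $k\in\mathbb{R}$ let $$\lambda_1=\sqrt{k^2-\frac{\omega^2}{C_s^2}},\qquad \lambda_2=\sqrt{k^2-\frac{\omega^2}{C_p^2}}$$ (complex square roots), which together with $-\lambda_1,-\lambda_2$ are the roots of the characteristic equation of the Navier equations Fourier transformed in $y$. Consider the classical parallel Schwarz algorithm for the time-harmonic Navier equations on $\mathbb{R}^2$ with the two subdomains $\Omega_1=(-\infty,\delta)\times\mathbb{R}$ and $\Omega_2=(0,\infty)\times\mathbb{R}$, as specified in the context. Then, for given initial guesses $\mathbf{u}_1^0\in (L^2(\Omega_1))^2$ and $\mathbf{u}_2^0\in (L^2(\Omega_2))^2$, each Fourier mode $k$ in the algorithm converges with the convergence factor (the spectral radius of the iteration matrix over a double iteration, as defined in the context) $$\rho_{cla}(k,\omega,C_p,C_s,\delta)=\max\{|r_+|,|r_-|\},$$ where $$r_\pm=\frac{X^2}{2}+e^{-\delta(\lambda_1+\lambda_2)}\pm\frac12\sqrt{X^2\left(X^2+4e^{-\delta(\lambda_1+\lambda_2)}\right)},\qquad X=\frac{k^2+\lambda_1\lambda_2}{k^2-\lambda_1\lambda_2}\left(e^{-\lambda_1\delta}-e^{-\lambda_2\delta}\right).$$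
   Context: The time-harmonic Navier equations for the displacement $\mathbf{u}=(u_x,u_z):\Omega\to\mathbb{C}^2$ are $$-(\Delta^e+\omega^2\rho)\mathbf{u}=\mathbf{f}\ \text{ in }\Omega,\qquad \Delta^e\mathbf{u}=\mu\Delta\mathbf{u}+(\lambda+\mu)\nabla(\nabla\cdot\mathbf{u}),$$ with constant density $\rho$, Lamé coefficients $\lambda,\mu$ and frequency $\omega$. Here $\Omega=\mathbb{R}^2$ with coordinates $(x,y)$; the first component of $\mathbf u$ is in the $x$ direction, the second in the $y$ direction. Classical parallel Schwarz algorithm: for $n=1,2,\dots$ solve $$-(\Delta^e+\omega^2\rho)\mathbf{u}_1^n=\mathbf{f}\ \text{in }\Omega_1,\quad \mathbf{u}_1^n=\mathbf{u}_2^{n-1}\ \text{on }x=\delta,$$ $$-(\Delta^e+\omega^2\rho)\mathbf{u}_2^n=\mathbf{f}\ \text{in }\Omega_2,\quad \mathbf{u}_2^n=\mathbf{u}_1^{n-1}\ \text{on }x=0.$$ By linearity, convergence is studied for the error, i.e. for $\mathbf{f}=0$ (convergence to the zero solution). Fourier transform in $y$: $\hat{\mathbf u}(x,k)=\int_{-\infty}^\infty e^{-iky}\mathbf u(x,y)\,dy$. For $\mathbf f=0$ the Fourier transformed equations are $$[(\lambda+2\mu)\partial_x^2+(\rho\omega^2-\mu k^2)]\hat u_x+ik(\mu+\lambda)\partial_x\hat u_z=0,$$ $$[\mu\partial_x^2+(\rho\omega^2-(\lambda+2\mu)k^2)]\hat u_z+ik(\mu+\lambda)\partial_x\hat u_x=0.$$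 The square roots $\lambda_1,\lambda_2$ are principal ones: positive real when the radicand is positive, and $i$ times a positive real when it is negative. The subdomain solutions are required to be bounded and outgoing at infinity, which means that for $n\ge1$ they have the form $$\hat{\mathbf u}_1^n(x,k)=\alpha_1^n\begin{pmatrix}k\\ i\lambda_1\end{pmatrix}e^{\lambda_1x}+\alpha_2^n\begin{pmatrix}-i\lambda_2\\ k\end{pmatrix}e^{\lambda_2x},\qquad \hat{\mathbf u}_2^n(x,k)=\beta_1^n\begin{pmatrix}k\\ -i\lambda_1\end{pmatrix}e^{-\lambda_1x}+\beta_2^n\begin{pmatrix}i\lambda_2\\ k\end{pmatrix}e^{-\lambda_2x}.$$ Write these as $\hat{\mathbf u}_1^n=M_x\boldsymbol\alpha^n$ and $\hat{\mathbf u}_2^n=N_x\boldsymbol\beta^n$, with $M_x,N_x$ the corresponding $2\times2$ matrices, $\boldsymbol\alpha^n=(\alpha_1^n,\alpha_2^n)^T$, $\boldsymbol\beta^n=(\beta_1^n,\beta_2^n)^T$. The transmission conditions read $M_\delta\boldsymbol\alpha^n=N_\delta\boldsymbol\beta^{n-1}$ and $N_0\boldsymbol\beta^n=M_0\boldsymbol\alpha^{n-1}$, so over a double iteration $$\boldsymbol\alpha^{n+1}=R_\delta^1\boldsymbol\alpha^{n-1},\quad R_\delta^1=M_\delta^{-1}N_\delta N_0^{-1}M_0,\qquad \boldsymbol\beta^{n+1}=R_\delta^2\boldsymbol\beta^{n-1},\quad R_\delta^2=N_0^{-1}M_0M_\delta^{-1}N_\delta.$$ The convergence factor $\rho_{cla}(k,\omega,C_p,C_s,\delta)$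 of the mode $k$ is the spectral radius of $R_\delta^1$ (equivalently of $R_\delta^2$). *)

(* Defs.v *)
From HB Require Import structures.
From mathcomp Require Import all_boot all_order all_algebra.
From mathcomp Require Import all_classical all_reals all_analysis.
From mathcomp Require Import complex.

Set Implicit Arguments.
Unset Strict Implicit.
Unset Printing Implicit Defensive.

Import Order.TTheory GRing.Theory Num.Theory.
Import numFieldNormedType.Exports.

Local Open Scope classical_set_scope.
Local Open Scope complex_scope.
Local Open Scope ring_scope.

Section Complex.
Variable R : realType.
Implicit Types (f : R -> R[i]) (z : R[i]) (x : R).

Definition cexp z : R[i] :=
  Complex (expR (complex.Re z) * cos (complex.Im z))
          (expR (complex.Re z) * sin (complex.Im z)).

Definition cabs z : R := ComplexField.Normc.normc z.

Definition cderivable f x : Prop :=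
  derivable (fun t => complex.Re (f t)) x 1 /\
  derivable (fun t => complex.Im (f t)) x 1.

Definition cderive f x : R[i] :=
  Complex (derive1 (fun t => complex.Re (f t)) x)
          (derive1 (fun t => complex.Im (f t)) x).

Definition cintegrable f : Prop :=
  (@lebesgue_measure R).-integrable setT (fun t => (complex.Re (f t))%:E) /\
  (@lebesgue_measure R).-integrable setT (fun t => (complex.Im (f t))%:E).

Definition cintegral f : R[i] :=
  Complex (Rintegral (@lebesgue_measure R) setT (fun t => complex.Re (f t)))
          (Rintegral (@lebesgue_measure R) setT (fun t => complex.Im (f t))).

Definition mx22 (T : Type) (a b c d : T) : 'M[T]_2 :=
  \matrix_(i < 2, j < 2)
    if i == 0 then (if j == 0 then a else b) else (if j == 0 then c else d).

Definition spectral_radius n (A : 'M[R[i]]_n) : R :=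
  sup [set r : R | exists2 z : R[i], eigenvalue A z & r = cabs z].

End Complex.

Section Guesses.
Variable R : realType.

Definition square_integrable (D : set (R * R)) (u : R * R -> 'cV[R[i]]_2) :
    Prop :=
  forall j : 'I_2,
  [/\ measurable_fun D (fun p => complex.Re (u p j 0)),
      measurable_fun D (fun p => complex.Im (u p j 0)) &
      (\int[(@lebesgue_measure R \x @lebesgue_measure R)%E]_(p in D)
         ((cabs (u p j 0)) ^+ 2)%:E < +oo)%E].

(* [uhat] is the mode k of the transform of u in its second variable. It is
   prescribed by the Fourier integral wherever this integral converges
   absolutely and left unconstrained elsewhere, because a square integrable u
   need not be integrable along every line x = const. *)
Definition fourier_mode (D : set R) (u : R * R -> 'cV[R[i]]_2) (k : R)
    (uhat : R -> 'cV[R[i]]_2) : Prop :=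
  forall (x : R) (j : 'I_2), D x -> cintegrable (fun y => u (x, y) j 0) ->
    uhat x j 0 = cintegral (fun y => cexp (- ('i%C * (k * y)%:C)) * u (x, y) j 0).

End Guesses.

Section Navier.
Variable R : realType.

Definition pressure_speed (lambda mu rho : R) : R :=
  Num.sqrt ((lambda + 2 * mu) / rho).

Definition shear_speed (mu rho : R) : R := Num.sqrt (mu / rho).

(* [sqrtc] is the principal square root: its values have nonnegative real part,
   and on a negative real it is 'i times a positive real. *)
Definition wave_root (k omega C : R) : R[i] :=
  sqrtc ((k ^+ 2 - omega ^+ 2 / C ^+ 2)%:C).

(* Obtained from the Fourier transformed equations by replacing the derivative
   in x by the indeterminate. *)
Definition navier_symbol (lambda mu rho omega k : R) : 'M[{poly R[i]}]_2 :=
  mx22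
    ((lambda + 2 * mu)%:C *: 'X^2 + ((rho * omega ^+ 2 - mu * k ^+ 2)%:C)%:P)
    (('i%C * (k * (mu + lambda))%:C) *: 'X)
    (('i%C * (k * (mu + lambda))%:C) *: 'X)
    (mu%:C *: 'X^2 +
       ((rho * omega ^+ 2 - (lambda + 2 * mu) * k ^+ 2)%:C)%:P).

Definition navier_charpoly (lambda mu rho omega k : R) : {poly R[i]} :=
  \det (navier_symbol lambda mu rho omega k).

Definition solves_navier_mode (lambda mu rho omega k : R) (D : set R)
    (u : R -> 'cV[R[i]]_2) : Prop :=
  let ux := fun x => u x 0 0 in
  let uz := fun x => u x 1 0 in
  forall x, D x ->
  [/\ cderivable ux x /\ cderivable (cderive ux) x,
      cderivable uz x /\ cderivable (cderive uz) x,
      (lambda + 2 * mu)%:C * cderive (cderive ux) x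
        + (rho * omega ^+ 2 - mu * k ^+ 2)%:C * ux x
        + 'i%C * (k * (mu + lambda))%:C * cderive uz x = 0 &
      mu%:C * cderive (cderive uz) x
        + (rho * omega ^+ 2 - (lambda + 2 * mu) * k ^+ 2)%:C * uz x
        + 'i%C * (k * (mu + lambda))%:C * cderive ux x = 0].

(* The columns of [Mmx] span the bounded outgoing modes on the left subdomain,
   those of [Nmx] the ones on the right subdomain; l1 and l2 are the roots
   belonging to the shear and to the pressure speed. *)
Definition Mmx (k : R) (l1 l2 : R[i]) (x : R) : 'M[R[i]]_2 :=
  mx22 (k%:C * cexp (l1 * x%:C))         (- ('i%C * l2) * cexp (l2 * x%:C))
       (('i%C * l1) * cexp (l1 * x%:C))  (k%:C * cexp (l2 * x%:C)).

Definition Nmx (k : R) (l1 l2 : R[i]) (x : R) : 'M[R[i]]_2 :=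
  mx22 (k%:C * cexp (- l1 * x%:C))          (('i%C * l2) * cexp (- l2 * x%:C))
       (- ('i%C * l1) * cexp (- l1 * x%:C)) (k%:C * cexp (- l2 * x%:C)).

Definition iter_mx1 (k : R) (l1 l2 : R[i]) (delta : R) : 'M[R[i]]_2 :=
  invmx (Mmx k l1 l2 delta) *m Nmx k l1 l2 delta
    *m invmx (Nmx k l1 l2 0) *m Mmx k l1 l2 0.

Definition iter_mx2 (k : R) (l1 l2 : R[i]) (delta : R) : 'M[R[i]]_2 :=
  invmx (Nmx k l1 l2 0) *m Mmx k l1 l2 0
    *m invmx (Mmx k l1 l2 delta) *m Nmx k l1 l2 delta.

(* The Fourier mode k of the parallel Schwarz algorithm for zero right-hand
   side, i.e. of the error. For n >= 1, being bounded and outgoing at infinity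
   is having the form [Mmx *m alpha n], resp. [Nmx *m beta n]; the values of
   alpha and beta at 0 play no role. The modes are taken on the closed half
   lines so that they carry their traces on the interfaces. *)
Record schwarz_mode (lambda mu rho omega delta : R)
    (u1_0 u2_0 : R * R -> 'cV[R[i]]_2) (k : R)
    (u1 u2 : nat -> R -> 'cV[R[i]]_2) (alpha beta : nat -> 'cV[R[i]]_2) :
    Prop := SchwarzMode {
  _ : fourier_mode [set x | x <= delta] u1_0 k (u1 0%N);
  _ : fourier_mode [set x | 0 <= x] u2_0 k (u2 0%N);
  _ : forall n, (1 <= n)%N ->
        solves_navier_mode lambda mu rho omega k [set x | x < delta] (u1 n);
  _ : forall n, (1 <= n)%N ->
        solves_navier_mode lambda mu rho omega k [set x | 0 < x] (u2 n);
  _ : forall n x, (1 <= n)%N -> x <= delta ->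
        u1 n x = Mmx k (wave_root k omega (shear_speed mu rho))
                   (wave_root k omega (pressure_speed lambda mu rho)) x
                 *m alpha n;
  _ : forall n x, (1 <= n)%N -> 0 <= x ->
        u2 n x = Nmx k (wave_root k omega (shear_speed mu rho))
                   (wave_root k omega (pressure_speed lambda mu rho)) x
                 *m beta n;
  _ : forall n, (1 <= n)%N -> u1 n delta = u2 n.-1 delta;
  _ : forall n, (1 <= n)%N -> u2 n 0 = u1 n.-1 0
}.

Definition rho_cla (k omega Cp Cs delta : R) : R :=
  spectral_radius (iter_mx1 k (wave_root k omega Cs) (wave_root k omega Cp) delta).

Definition X_cla (k : R) (l1 l2 : R[i]) (delta : R) : R[i] :=
  ((k ^+ 2)%:C + l1 * l2) / ((k ^+ 2)%:C - l1 * l2) *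
  (cexp (- (l1 * delta%:C)) - cexp (- (l2 * delta%:C))).

(* [s] is 1 for r_+ and -1 for r_-. *)
Definition r_cla (s : R[i]) (k : R) (l1 l2 : R[i]) (delta : R) : R[i] :=
  let X := X_cla k l1 l2 delta in
  let E := cexp (- (delta%:C * (l1 + l2))) in
  X ^+ 2 / 2 + E + s * (2^-1 * sqrtc (X ^+ 2 * (X ^+ 2 + 4 * E))).

End Navier.

(* Main.v *)
(** Both iteration matrices are products of the same two 2x2 matrices in opposite
order, so they share their trace and determinant, hence their spectrum. Writing
[E = e^(-delta (l1 + l2))], the determinant is [E^2] and the trace is
[X^2 + 2 E]; the roots of [z^2 - (X^2 + 2 E) z + E^2] are [r_+] and [r_-]. The
matrices are invertible because [k^2 <> l1 l2]. *)

Require Import Defs.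
From HB Require Import structures.
From mathcomp Require Import all_boot all_order all_algebra.
From mathcomp Require Import all_classical all_reals all_analysis.
From mathcomp Require Import complex.
From mathcomp Require Import ring lra.

Set Implicit Arguments.
Unset Strict Implicit.
Unset Printing Implicit Defensive.

Import Order.TTheory GRing.Theory Num.Theory.
Import numFieldNormedType.Exports.

Local Open Scope classical_set_scope.
Local Open Scope complex_scope.
Local Open Scope ring_scope.

(** * Explicit algebra of 2x2 matrices *)

Lemma det_mx22 (A : comNzRingType) (a b c d : A) :
  \det (mx22 a b c d) = a * d - b * c.
Proof.
rewrite (expand_det_row _ 0) !big_ord_recl big_ord0 /cofactor !det_mx11 !mxE /=.
by ring.
Qed.

Lemma mxtrace_mx22 (A : pzRingType) (a b c d : A) : \tr (mx22 a b c d) = a + d.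
Proof. by rewrite /mxtrace !big_ord_recl big_ord0 !mxE addr0. Qed.

Lemma mul_mx22 (A : pzRingType) (a b c d a' b' c' d' : A) :
  mx22 a b c d *m mx22 a' b' c' d' =
  mx22 (a * a' + b * c') (a * b' + b * d') (c * a' + d * c') (c * b' + d * d').
Proof.
apply/matrixP => i j; rewrite !mxE !big_ord_recl big_ord0 !mxE /= addr0.
by case: eqP => _; case: eqP.
Qed.

(** With explicit inverses the trace of the iteration matrix becomes a rational function of the
    entries, within reach of [field]. *)
Lemma invmx_mx22 (F : fieldType) (a b c d : F) (D := a * d - b * c) :
  D != 0 -> invmx (mx22 a b c d) = mx22 (d / D) (- b / D) (- c / D) (a / D).
Proof.
move=> D0; have U : mx22 a b c d \in unitmx by rewrite unitmxE det_mx22 unitfE.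
apply: (can_inj (mulKmx U)); rewrite mulmxV // mul_mx22.
apply/matrixP => i j; rewrite !mxE /D.
by case: i => [[|[|[]]]] // ?; case: j => [[|[|[]]]] // ? /=; field.
Qed.

(* Applied with m1 = 'i l1 and m2 = 'i l2: since m1 m2 = - l1 l2, the imaginary
   unit disappears and the identity is one of rational functions. *)
Lemma mxtrace_schwarz (F : fieldType) (k m1 m2 e1 e2 : F)
    (d := k ^+ 2 + m1 * m2) :
  d != 0 -> e1 != 0 -> e2 != 0 ->
  \tr (invmx (mx22 (k * e1^-1) (- m2 * e2^-1) (m1 * e1^-1) (k * e2^-1))
       *m mx22 (k * e1) (m2 * e2) (- m1 * e1) (k * e2)
       *m invmx (mx22 k m2 (- m1) k)
       *m mx22 k (- m2) m1 k) =
  ((k ^+ 2 - m1 * m2) / d * (e1 - e2)) ^+ 2 + 2 * (e1 * e2).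
Proof.
move=> d0 e10 e20.
(* Both determinants are [d] up to a nonzero factor, so both inverses are given by the explicit
   formula. *)
have D1 : (k * e1^-1) * (k * e2^-1) - (- m2 * e2^-1) * (m1 * e1^-1)
    = d / (e1 * e2) by rewrite /d; field; rewrite e10 e20.
have D2 : k * k - m2 * (- m1) = d by rewrite /d; ring.
rewrite !invmx_mx22 ?D1 ?D2 //; last by rewrite mulf_neq0 ?invr_eq0 ?mulf_neq0.
rewrite !mul_mx22 mxtrace_mx22 /d.
by field; rewrite d0 e10 e20.
Qed.

Lemma char_poly_mx22 (A : comNzRingType) (M : 'M[A]_2) :
  char_poly M = 'X^2 - \tr M *: 'X + (\det M)%:P.
Proof.
apply/polyP => i; rewrite coefD coefB coefZ coefXn coefX coefC; case: i => [|[|[|i]]] /=.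
- by rewrite char_poly_det sqrrN expr1n mul1r mulr0 subr0 add0r.
- by rewrite (char_poly_trace M) // mulr1 add0r addr0.
- have /monicP := char_poly_monic M; rewrite lead_coefE size_char_poly /= => ->.
  by rewrite mulr0 subr0 addr0.
- by rewrite nth_default ?size_char_poly // mulr0 subr0 addr0.
Qed.

Lemma sup_pair (R : realType) (x y : R) : sup [set x; y] = Num.max x y.
Proof.
apply/eqP; rewrite eq_le; apply/andP; split.
  apply: ge_sup; first by exists x; left.
  by move=> _ [] ->; rewrite le_max lexx ?orbT.
have ub : has_ubound [set x; y].
  by exists (Num.max x y) => _ [] ->; rewrite le_max lexx ?orbT.
by rewrite ge_max; apply/andP; split; apply: ub_le_sup => //; [left | right].
Qed.

(** * Complex exponential, spectral radius and wave roots *)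

Section Complex.
Variable R : realType.
Implicit Types (z w p q : R[i]).

Lemma cexp0 : cexp (0 : R[i]) = 1.
Proof. by rewrite /cexp /= expR0 cos0 sin0 mul1r mulr0. Qed.

Lemma cexpD z w : cexp (z + w) = cexp z * cexp w.
Proof.
case: z w => [a b] [c d]; rewrite /cexp /= expRD sinD cosD.
by apply/eqP; rewrite eq_complex /=; apply/andP; split; apply/eqP; ring.
Qed.

Lemma cexp_neq0 z : cexp z != 0.
Proof.
apply/eqP => z0; have := cexpD z (- z); rewrite subrr cexp0 z0 mul0r.
by move/eqP; rewrite oner_eq0.
Qed.

Lemma cexpN z : cexp (- z) = (cexp z)^-1.
Proof.
apply: (mulfI (cexp_neq0 z)).
by rewrite -cexpD subrr cexp0 mulfV // cexp_neq0.
Qed.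

(** By Vieta the characteristic polynomial is (z - p)(z - q), so the spectrum is {p, q}, also when p
    = q. *)
Lemma spectral_radius_mx22 (A : 'M[R[i]]_2) p q :
  \tr A = p + q -> \det A = p * q ->
  spectral_radius A = Num.max (cabs p) (cabs q).
Proof.
move=> trA detA; rewrite -sup_pair /spectral_radius; congr (sup _).
have E z : eigenvalue A z = (z == p) || (z == q).
  rewrite eigenvalue_root_char char_poly_mx22 trA detA rootE !hornerE.
  rewrite -[z == p]subr_eq0 -[z == q]subr_eq0 -mulf_eq0; congr (_ == 0); ring.
apply/seteqP; split => [_ [z + ->] | _ [] ->].
- by rewrite E => /orP[] /eqP ->; [left | right].
- by exists p => //; rewrite E eqxx.
- by exists q => //; rewrite E eqxx orbT.
Qed.

(** Fixes the branch: the sign of a product of two such roots depends on it. *)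
Lemma sqrtc_neg (x : R) : 0 <= x -> sqrtc (- x)%:C = 'i%C * (Num.sqrt x)%:C.
Proof.
(* [sqrtc] gives a zero imaginary part the sign 1, which selects the upper half of the imaginary
   axis. *)
move=> x0; rewrite /sqrtc /= eqxx expr0n addr0 sqrrN sqrtr_sqr ger0_norm //.
have -> : (x - - x) / 2 = x by field.
rewrite subrr mul0r sqrtr0.
by apply/eqP; rewrite eq_complex /=; apply/andP; split; apply/eqP; ring.
Qed.

Lemma wave_root_sqr (k omega C : R) :
  wave_root k omega C ^+ 2 = (k ^+ 2)%:C - (omega ^+ 2 / C ^+ 2)%:C.
Proof. by rewrite /wave_root sqr_sqrtc rmorphB. Qed.

(* With a, b the numbers omega^2 / C^2: if k^2 = l1 l2, squaring gives
   k^2 (a + b) = a b, so k^2 < a and k^2 < b: both roots are then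
   positive multiples of 'i and their product is negative. *)
Lemma wave_root_det_neq0 (k omega C1 C2 : R) :
  0 < omega -> 0 < C1 -> 0 < C2 ->
  (k ^+ 2)%:C - wave_root k omega C1 * wave_root k omega C2 != 0.
Proof.
move=> w0 c1 c2; rewrite /wave_root.
have: 0 < omega ^+ 2 / C1 ^+ 2 by rewrite divr_gt0 ?exprn_gt0.
have: 0 < omega ^+ 2 / C2 ^+ 2 by rewrite divr_gt0 ?exprn_gt0.
move: (_ / C2 ^+ 2) (_ / C1 ^+ 2) => b a b0 a0.
rewrite subr_eq0; apply/eqP.
have := sqr_ge0 k; move: (k ^+ 2) => K K0 E.
have EK : K ^+ 2 = (K - a) * (K - b).
  by apply: complexI; rewrite [RHS]rmorphM [LHS]rmorphXn /= E exprMn !sqr_sqrtc.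
(* [EK] amounts to b (a - K) = K a, so a - K is nonnegative; if it vanished, K = 0 and then a = 0
   would follow. The next line is symmetric. *)
have Ka : 0 < a - K by nra.
have Kb : 0 < b - K by nra.
move: E; rewrite -[K - a]opprB -[K - b]opprB !sqrtc_neg ?ltW //.
rewrite mulrACA -expr2 sqr_i mulN1r -rmorphM -rmorphN /= => /complexI E.
have : 0 < Num.sqrt (a - K) * Num.sqrt (b - K) by rewrite mulr_gt0 ?sqrtr_gt0.
by rewrite -oppr_lt0 -E ltNge K0.
Qed.

End Complex.

(** * Determinants of the mode matrices *)

Lemma det_Mmx (R : realType) (k : R) (l1 l2 : R[i]) (x : R) :
  \det (Mmx k l1 l2 x) =
  ((k ^+ 2)%:C - l1 * l2) * (cexp (l1 * x%:C) * cexp (l2 * x%:C)).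
Proof.
rewrite /Mmx det_mx22 rmorphXn /=; set e1 := cexp _; set e2 := cexp _.
transitivity ((k%:C ^+ 2 + 'i%C ^+ 2 * (l1 * l2)) * (e1 * e2)); first by ring.
by rewrite sqr_i mulN1r.
Qed.

(** Passing to the other subdomain negates both roots, which leaves the product l1 l2 in the
    determinant unchanged. *)
Lemma NmxE (R : realType) (k : R) (l1 l2 : R[i]) (x : R) :
  Nmx k l1 l2 x = Mmx k (- l1) (- l2) x.
Proof. by rewrite /Nmx /Mmx !mulrN opprK. Qed.

Lemma det_Nmx (R : realType) (k : R) (l1 l2 : R[i]) (x : R) :
  \det (Nmx k l1 l2 x) =
  ((k ^+ 2)%:C - l1 * l2) * (cexp (- l1 * x%:C) * cexp (- l2 * x%:C)).
Proof. by rewrite NmxE det_Mmx mulrNN. Qed.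

(** * Spectrum of the iteration matrices *)

Section Iteration.
Variables (R : realType) (k delta : R) (l1 l2 : R[i]).
Hypothesis d0 : (k ^+ 2)%:C - l1 * l2 != 0.

Lemma Mmx_unit x : Mmx k l1 l2 x \in unitmx.
Proof. by rewrite unitmxE det_Mmx unitfE !mulf_neq0 ?cexp_neq0. Qed.

Lemma Nmx_unit x : Nmx k l1 l2 x \in unitmx.
Proof. by rewrite unitmxE det_Nmx unitfE !mulf_neq0 ?cexp_neq0. Qed.

Let X := X_cla k l1 l2 delta.
Let E := cexp (- (delta%:C * (l1 + l2))).

Lemma cexp_deltaD : E = cexp (- (l1 * delta%:C)) * cexp (- (l2 * delta%:C)).
Proof. by rewrite -cexpD -opprD -mulrDl mulrC. Qed.

(** All factors k^2 - l1 l2 cancel; what remains is the quotient of the exponentials of [Nmx] and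
    [Mmx] at [delta]. *)
Lemma det_iter_mx1 : \det (iter_mx1 k l1 l2 delta) = E ^+ 2.
Proof.
rewrite /iter_mx1 !det_mulmx !det_inv !det_Mmx !det_Nmx !mulr0 cexp0 cexp_deltaD.
rewrite !mulNr !cexpN; move: d0 (cexp_neq0 (l1 * delta%:C)) (cexp_neq0 (l2 * delta%:C)).
move: (_ - _) (cexp _) (cexp _) => d e1 e2 dn0 e1n0 e2n0.
by field; rewrite dn0 e1n0 e2n0.
Qed.

Lemma tr_iter_mx1 : \tr (iter_mx1 k l1 l2 delta) = X ^+ 2 + 2 * E.
Proof.
have m12 : ('i%C * l1) * ('i%C * l2) = - (l1 * l2).
  by rewrite mulrACA -expr2 sqr_i mulN1r.
rewrite /X /X_cla cexp_deltaD.
have := @mxtrace_schwarz _ k%:C ('i%C * l1) ('i%C * l2)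
  (cexp (- (l1 * delta%:C))) (cexp (- (l2 * delta%:C))).
rewrite m12 opprK -rmorphXn /= => <- //; rewrite ?cexp_neq0 //.
(* The matrices at [delta] carry the decaying exponentials or their inverses; those at 0 carry
   none. *)
by rewrite /iter_mx1 /Mmx /Nmx !mulr0 cexp0 !mulr1 !mulNr -!cexpN !opprK.
Qed.

Lemma iter_mx2_cycle : exists A B,
  iter_mx1 k l1 l2 delta = A *m B /\ iter_mx2 k l1 l2 delta = B *m A.
Proof.
exists (invmx (Mmx k l1 l2 delta) *m Nmx k l1 l2 delta).
exists (invmx (Nmx k l1 l2 0) *m Mmx k l1 l2 0).
by rewrite /iter_mx1 /iter_mx2 !mulmxA.
Qed.

Lemma r_cla_sum : r_cla 1 k l1 l2 delta + r_cla (-1) k l1 l2 delta = X ^+ 2 + 2 * E.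
Proof. by rewrite /r_cla -/X -/E; field. Qed.

(** A difference of squares: the root enters only through its square, whatever its branch. *)
Lemma r_cla_prod : r_cla 1 k l1 l2 delta * r_cla (-1) k l1 l2 delta = E ^+ 2.
Proof.
rewrite /r_cla -/X -/E; set S := sqrtc _.
transitivity ((X ^+ 2 / 2 + E) ^+ 2 - S ^+ 2 / 4); first by field.
by rewrite sqr_sqrtc; field.
Qed.

Lemma spectral_radius_iter_mx1 : spectral_radius (iter_mx1 k l1 l2 delta) =
  Num.max (cabs (r_cla 1 k l1 l2 delta)) (cabs (r_cla (-1) k l1 l2 delta)).
Proof.
apply: spectral_radius_mx22; first by rewrite tr_iter_mx1 r_cla_sum.
by rewrite det_iter_mx1 r_cla_prod.
Qed.

Lemma spectral_radius_iter_mx2 :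
  spectral_radius (iter_mx2 k l1 l2 delta) = spectral_radius (iter_mx1 k l1 l2 delta).
Proof.
rewrite spectral_radius_iter_mx1.
have [A [B [R1 R2]]] := iter_mx2_cycle.
apply: spectral_radius_mx22.
  by rewrite R2 mxtrace_mulC -R1 tr_iter_mx1 r_cla_sum.
by rewrite R2 det_mulmx mulrC -det_mulmx -R1 det_iter_mx1 r_cla_prod.
Qed.

End Iteration.

(** * Roots of the Navier characteristic polynomial *)

Lemma navier_charpoly_factor (R : realType) (lambda mu rho omega k : R)
    (l1 := wave_root k omega (shear_speed mu rho))
    (l2 := wave_root k omega (pressure_speed lambda mu rho)) (z : R[i]) :
  0 < lambda -> 0 < mu -> 0 < rho ->
  (navier_charpoly lambda mu rho omega k).[z] =
  ((lambda + 2 * mu) * mu)%:C * ((z - l1) * (z + l1) * ((z - l2) * (z + l2))).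
Proof.
move=> la m r; have lm : 0 < lambda + 2 * mu by rewrite addr_gt0 ?mulr_gt0.
have -> : (z - l1) * (z + l1) * ((z - l2) * (z + l2)) =
    (z ^+ 2 - l1 ^+ 2) * (z ^+ 2 - l2 ^+ 2) by ring.
rewrite /l1 /l2 !wave_root_sqr /shear_speed /pressure_speed !sqr_sqrtr ?divr_ge0 ?ltW //.
rewrite /navier_charpoly /navier_symbol det_mx22.
rewrite !(hornerD, hornerN, hornerM, hornerZ, hornerXn, hornerX, hornerC).
set A := (rho * _ - mu * _)%:C; set B := (rho * _ - _)%:C.
set K := (k * _)%:C.
(* The off-diagonal product is isolated with its factor 'i^2 = -1; afterwards only a real rational
   identity in z^2 is left. *)
transitivity (((lambda + 2 * mu)%:C * z ^+ 2 + A) * (mu%:C * z ^+ 2 + B)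
  - 'i%C ^+ 2 * K ^+ 2 * z ^+ 2); first by ring.
rewrite sqr_i /A /B /K !(rmorphB, rmorphD, rmorphM, rmorphXn, fmorphV) /=.
have mC : mu%:C != 0 by rewrite fmorph_eq0 gt_eqF.
have rC : rho%:C != 0 by rewrite fmorph_eq0 gt_eqF.
have lC : lambda%:C + 2%:R%:C * mu%:C != 0.
  by rewrite -rmorphM -rmorphD fmorph_eq0 gt_eqF.
rewrite rmorph_nat in lC *.
by field; rewrite mC rC lC.
Qed.

(** * Double-iteration recursion and convergence factor *)

Theorem theorem1 (R : realType) (lambda mu rho omega delta : R)
    (lambda_gt0 : 0 < lambda) (mu_gt0 : 0 < mu) (rho_gt0 : 0 < rho)
    (omega_gt0 : 0 < omega) (delta_ge0 : 0 <= delta)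
    (u1_0 u2_0 : R * R -> 'cV[R[i]]_2)
    (u1_0_L2 : square_integrable [set p : R * R | p.1 < delta] u1_0)
    (u2_0_L2 : square_integrable [set p : R * R | 0 < p.1] u2_0)
    (k : R) :
  let Cp := pressure_speed lambda mu rho in
  let Cs := shear_speed mu rho in
  let l1 := wave_root k omega Cs in
  let l2 := wave_root k omega Cp in
  let R1 := iter_mx1 k l1 l2 delta in
  let R2 := iter_mx2 k l1 l2 delta in
  let r_plus := r_cla 1 k l1 l2 delta in
  let r_minus := r_cla (-1) k l1 l2 delta in
  [/\ forall z : R[i], root (navier_charpoly lambda mu rho omega k) z
                       = (z \in [:: l1; - l1; l2; - l2]),
      Mmx k l1 l2 delta \in unitmx /\ Nmx k l1 l2 0 \in unitmx,
      forall (u1 u2 : nat -> R -> 'cV[R[i]]_2) (alpha beta : nat -> 'cV[R[i]]_2),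
        schwarz_mode lambda mu rho omega delta u1_0 u2_0 k u1 u2 alpha beta ->
        forall n : nat, (2 <= n)%N ->
          alpha n.+1 = R1 *m alpha n.-1 /\ beta n.+1 = R2 *m beta n.-1,
      rho_cla k omega Cp Cs delta = Num.max (cabs r_plus) (cabs r_minus) &
      spectral_radius R2 = rho_cla k omega Cp Cs delta].
Proof.
move=> Cp Cs l1 l2 R1 R2 r_plus r_minus.
have Cp0 : 0 < Cp by rewrite sqrtr_gt0 divr_gt0 ?addr_gt0 ?mulr_gt0.
have Cs0 : 0 < Cs by rewrite sqrtr_gt0 divr_gt0.
have d0 : (k ^+ 2)%:C - l1 * l2 != 0 by exact: wave_root_det_neq0.
split.
- move=> z; have c0 : (lambda + 2 * mu) * mu != 0.
    by rewrite gt_eqF ?mulr_gt0 ?addr_gt0 ?mulr_gt0.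
  rewrite rootE navier_charpoly_factor // !mulf_eq0 fmorph_eq0 (negPf c0) /=.
  by rewrite !inE !subr_eq0 !addr_eq0 !orbA.
- by rewrite Mmx_unit // Nmx_unit.
- move=> u1 u2 alpha beta [_ _ _ _ U1 U2 T1 T2] n n2.
  have n0 : (0 < n)%N by exact: ltnW.
  (* The modal form is available only from index 1 on, since the initial guesses need not have it;
     hence the bound 2 on [n]. *)
  have n10 : (0 < n.-1)%N by rewrite -ltnS prednK.
  (* The transmission condition at [delta], solved for the new coefficients; [b_of_a] does the same
     at 0. *)
  have a_of_b m : (0 < m)%N ->
      alpha m.+1 = invmx (Mmx k l1 l2 delta) *m Nmx k l1 l2 delta *m beta m.
    move=> m0; have := T1 m.+1 isT; rewrite /= U1 // U2 //.
    by move=> /(canRL (mulKmx (Mmx_unit d0 delta))); rewrite mulmxA.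
  have b_of_a m : (0 < m)%N ->
      beta m.+1 = invmx (Nmx k l1 l2 0) *m Mmx k l1 l2 0 *m alpha m.
    move=> m0; have := T2 m.+1 isT; rewrite /= U1 // U2 //.
    by move=> /(canRL (mulKmx (Nmx_unit d0 0))); rewrite mulmxA.
  (* Chaining the single steps from n - 1 to n and from n to n + 1 gives the double iteration. *)
  have an := a_of_b _ n10; have bn := b_of_a _ n10; rewrite !prednK // in an bn.
  by rewrite a_of_b // bn b_of_a // an /R1 /R2 /iter_mx1 /iter_mx2 !mulmxA.
- exact: (spectral_radius_iter_mx1 delta d0).
- exact: (spectral_radius_iter_mx2 delta d0).
Qed.
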